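(* We have the $\mathrm{des}$-Wilf equivalence $\underline{231}4\overset{\mathrm{des}}{\sim}\underline{241}3$.
   Context: $\mathfrak{S}_n$ is the set of permutations of $\{1,\ldots,n\}$ in one-line notation, and $\mathrm{des}(\pi)=|\{i\in[n-1]:\pi_i>\pi_{i+1}\}|$. An occurrence of the pattern $\underline{abc}d$ (where $abcd\in\mathfrak{S}_4$) in $\pi$ is a subsequence $\pi_i\pi_{i+1}\pi_{i+2}\pi_j$ with $j>i+2$ order-isomorphic to $abcd$. $\mathfrak{S}_n(\omega)$ is the set of permutations in $\mathfrak{S}_n$ with no occurrence of $\omega$. $\omega\overset{\mathrm{des}}{\sim}\omega'$ means $|\{\pi\in\mathfrak{S}_n(\omega):\mathrm{des}(\pi)=m\}|=|\{\pi\in\mathfrak{S}_n(\omega'):\mathrm{des}(\pi)=m\}|$ for all $n\ge1$ and $m\ge0$. *)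

(* Defs.v *)
From mathcomp Require Import all_boot all_fingroup.

Set Implicit Arguments.
Unset Strict Implicit.
Unset Printing Implicit Defensive.

Section Permutations.

Variable n : nat.
Implicit Type pi : 'S_n.

(* 'S_n acts on 'I_n = {0, ..., n-1}, so the letters are shifted by one to lie
   in {1, ..., n}; the positions of the resulting word still start at 0. *)
Definition one_line pi : seq nat := [seq (pi i).+1 | i <- enum 'I_n].

Definition des pi : nat :=
  #|[set i : 'I_n.-1 | nth 0 (one_line pi) i > nth 0 (one_line pi) i.+1]|.

End Permutations.

Definition order_isomorphic (s t : seq nat) : bool :=
  (size s == size t) &&
  [forall i : 'I_(size s), forall j : 'I_(size s),
     (nth 0 s i < nth 0 s j) == (nth 0 t i < nth 0 t j)].

(* The word w = abcd, a permutation of 1234 in one-line notation, stands for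
   the vincular pattern whose first three letters are underlined: they must be
   matched by consecutive letters of pi. *)
Definition occurs_at (n : nat) (w : 4.-tuple nat) (pi : 'S_n) (i j : nat) :=
  (i.+2 < j) &&
  order_isomorphic
    [:: nth 0 (one_line pi) i; nth 0 (one_line pi) i.+1;
        nth 0 (one_line pi) i.+2; nth 0 (one_line pi) j] w.

Definition avoiders (n : nat) (w : 4.-tuple nat) : {set 'S_n} :=
  [set pi | ~~ [exists i : 'I_n, exists j : 'I_n, occurs_at w pi i j]].

Definition des_Wilf_equivalent (w w' : 4.-tuple nat) : Prop :=
  forall n m : nat, 1 <= n ->
    #|[set pi in avoiders n w | des pi == m]| =
    #|[set pi in avoiders n w' | des pi == m]|.

(* Main.v *)
Require Import Defs.
From mathcomp Require Import all_boot all_fingroup.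
From mathcomp Require Import zify.

Set Implicit Arguments.
Unset Strict Implicit.
Unset Printing Implicit Defensive.

(** Build permutations from right to left, prepending one letter at a time and
    keeping the words standardised: prepending [x] raises the letters that are
    at least [x].  When [x] is prepended to a word starting with [y z], a new
    occurrence of either pattern can only arise if [z < x <= y]; then none
    arises for 231-4 iff [y] is the maximum of the word, and none for 241-3 iff
    [x = y].  Above a word of size [m] on [0 .. m-1] starting with [z], the
    allowed pairs [(y, x)] with [z < x <= y <= m] are thus the [(m, x)] in the
    first case and the [(x, x)] in the second: either way there is exactly one
    for each [x] with [z < x <= m], creating one descent.  Hence the joint
    distributions of the first letter and [des] satisfy the same recurrence. *)

(** * Words built by prepending, their descents and avoidance *)

Definition prepend (x : nat) (s : seq nat) : seq nat := x :: map (bump x) s.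

Fixpoint words (n : nat) : seq (seq nat) :=
  if n is m.+1 then [seq prepend x s | s <- words m, x <- index_iota 0 m.+1]
  else [:: [::]].

Fixpoint ndes (s : seq nat) : nat :=
  if s is x :: t then (if t is y :: _ then nat_of_bool (y < x) else 0) + ndes t
  else 0.

(** Words of length at most one belong here: prepending to them cannot create an occurrence
    either. *)
Definition starts_up (s : seq nat) : bool :=
  if s is x :: y :: _ then x < y else true.

Definition avoids_head (Q : nat -> nat -> nat -> nat -> bool)
    (s : seq nat) : bool :=
  if s is x :: y :: z :: t then ~~ has (Q x y z) t else true.

Fixpoint avoids (Q : nat -> nat -> nat -> nat -> bool) (s : seq nat) : bool :=
  if s is _ :: t then avoids_head Q s && avoids Q t else true.

(** Connects the recursion, suited to prepending, with the positions used by [occurs_at]. *)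
Lemma avoidsP Q (s : seq nat) :
  reflect (forall i j, i.+2 < j -> j < size s ->
             ~~ Q (nth 0 s i) (nth 0 s i.+1) (nth 0 s i.+2) (nth 0 s j))
          (avoids Q s).
Proof.
elim: s => [|x s IHs] /=; first by apply: ReflectT => i j; rewrite ltn0.
apply: (iffP andP) => [[hx /IHs hs] [|i] [|j] //= ij js|H].
- case: j ij js => [|[|j]] // _ js.
  case: s hx js {IHs hs} => [|y [|z t]] //= /hasPn ht js.
  by apply/ht/mem_nth.
- exact: hs.
split; last by apply/IHs => i j ij js; apply: (H i.+1 j.+1).
case: s H {IHs} => [|y [|z t]] //= H.
apply/hasPn => u ut; rewrite -(nth_index 0 ut).
by apply: (H 0 (index u t).+3); rewrite //= !ltnS index_mem.
Qed.

(** * The two patterns as predicates on four letters *)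

Definition Q2314 a b c d := [&& c < a, a < b & b < d].
Definition Q2413 a b c d := [&& c < a, a < d & d < b].

Definition order_invariant (Q : nat -> nat -> nat -> nat -> bool) :=
  forall f, {mono f : x y / x < y} ->
  forall a b c d, Q (f a) (f b) (f c) (f d) = Q a b c d.

Definition starts_231 (Q : nat -> nat -> nat -> nat -> bool) :=
  forall a b c d, Q a b c d -> c < a < b.

Lemma order_invariant2314 : order_invariant Q2314.
Proof. by move=> f fm a b c d; rewrite /Q2314 !fm. Qed.

Lemma order_invariant2413 : order_invariant Q2413.
Proof. by move=> f fm a b c d; rewrite /Q2413 !fm. Qed.

Lemma starts_231_2314 : starts_231 Q2314.
Proof. by move=> a b c d /and3P[-> ->]. Qed.

Lemma starts_231_2413 : starts_231 Q2413.
Proof. by move=> a b c d /and3P[-> ad db]; apply: ltn_trans db. Qed.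

(** * Effect of one prepended letter *)

Lemma ltn_bump2 (h : nat) : {mono bump h : x y / x < y}.
Proof. by move=> x y; rewrite !ltnNge leq_bump2. Qed.

Lemma ndes_map (f : nat -> nat) (s : seq nat) :
  {mono f : x y / x < y} -> ndes (map f s) = ndes s.
Proof.
by move=> fm; elim: s => [|x [|y t] IHs] //=; rewrite fm; congr (_ + _).
Qed.

Lemma avoids_map Q (f : nat -> nat) (s : seq nat) :
  order_invariant Q -> {mono f : x y / x < y} ->
  avoids Q (map f s) = avoids Q s.
Proof.
move=> Qm fm; elim: s => [|x s IHs] //=; rewrite IHs; congr (_ && _).
case: s {IHs} => [|y [|z t]] //=; rewrite has_map; congr (~~ _).
by apply: eq_has => u /=; apply: Qm.
Qed.

(** Raising does not change which letters are below [x]. On the empty word the bound forces [x = 0],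
    which agrees with the default head [0]. *)
Lemma ndes_prepend (x : nat) (s : seq nat) :
  x <= size s -> ndes (prepend x s) = (head 0 s < x) + ndes s.
Proof.
case: s => [|y t]; first by rewrite /= leqn0 => /eqP ->.
move=> _; rewrite -(ndes_map (y :: t) (ltn_bump2 x)) /=.
by congr (nat_of_bool _ + _); rewrite /bump; lia.
Qed.

Lemma starts_up_prepend (x : nat) (s : seq nat) :
  x <= size s -> starts_up (prepend x s) = (x <= head 0 s).
Proof.
case: s => [|y t] /=; first by rewrite leqn0 => /eqP ->.
by move=> _; rewrite /bump; lia.
Qed.

(** Over a word starting with [y z], a 231 at the front requires [z < x <= y], against both [y < z]
    and [y < x]. *)
Lemma avoids_head_prepend Q (x : nat) (s : seq nat) :
  starts_231 Q ->
  starts_up s || (head 0 s < x) -> avoids_head Q (prepend x s).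
Proof.
move=> Qr; case: s => [|y [|z t]] //= h.
by apply/hasPn => u _; apply/negP => /Qr; move: h; rewrite /bump; lia.
Qed.

Lemma avoids_prepend Q (x : nat) (s : seq nat) : order_invariant Q ->
  avoids Q (prepend x s) = avoids_head Q (prepend x s) && avoids Q s.
Proof. by move=> Qm; rewrite -(avoids_map s Qm (ltn_bump2 x)). Qed.

(** * The words of size [n] are the permutations of [[0 .. n-1]] *)

Lemma size_words (n : nat) : size (words n) = n`!.
Proof.
elim: n => [|n IHn] //.
by rewrite [LHS]size_allpairs IHn size_iota subn0 factS mulnC.
Qed.

Lemma mem_wordsP (n : nat) (s : seq nat) :
  reflect [/\ size s = n, uniq s & all (ltn^~ n) s] (s \in words n).
Proof.
elim: n s => [|n IHn] s.
  rewrite inE; apply: (iffP eqP) => [->|[sz _ _]] //.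
  exact: size0nil.
apply: (iffP allpairsP) => [[[t x] /= [/IHn[st ut /allP ht]]]|[]].
  rewrite mem_index_iota => /= xn ->; split=> /=.
  - by rewrite size_map st.
  - rewrite (map_inj_uniq (can_inj (bumpK x))) ut andbT.
    by apply/mapP => -[v _]; rewrite /bump; lia.
  - rewrite xn; apply/allP => _ /mapP[v /ht/= vn ->]; rewrite /bump; lia.
case: s => [|x s] //= [sz] /andP[xs us] /andP[xn /allP hs].
have neq v : v \in s -> v != x by apply: contraL => /eqP ->.
(* Undo the prepending: lowering the letters above [x] closes the gap it leaves. *)
exists (map (unbump x) s, x) => /=; split.
- apply/IHn; split; first by rewrite size_map.
  + rewrite map_inj_in_uniq // => u v /neq ux /neq vx.
    by rewrite /unbump; lia.
  + apply/allP => _ /mapP[v vs ->]; move: (hs v vs) (neq v vs) => /=.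
    by rewrite /unbump; lia.
- by rewrite mem_index_iota.
rewrite /prepend -map_comp; congr (_ :: _).
rewrite -[LHS]map_id; apply/eq_in_map => v /neq vx /=.
by rewrite unbumpKcond (negbTE vx).
Qed.

Lemma words_mem (n : nat) (s : seq nat) (v : nat) :
  s \in words n -> (v \in s) = (v < n).
Proof.
case/mem_wordsP => sz us /allP sn.
have sub : {subset s <= iota 0 n} by move=> u /sn; rewrite mem_iota.
by rewrite (uniq_min_size us sub _).2 ?mem_iota // size_iota sz.
Qed.

Lemma size_word (n : nat) (s : seq nat) : s \in words n -> size s = n.
Proof. by case/mem_wordsP. Qed.

(** * Correspondence with ['S_n] *)

Definition word (n : nat) (pi : 'S_n) : seq nat :=
  [seq val (pi i) | i <- enum 'I_n].

Lemma one_lineE (n : nat) (pi : 'S_n) : one_line pi = map S (word pi).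
Proof. by rewrite /one_line /word -map_comp. Qed.

Lemma word_inj (n : nat) : injective (@word n).
Proof.
move=> p q /eq_in_map pq; apply/permP => i; apply: val_inj.
by apply: pq; rewrite mem_enum.
Qed.

Lemma word_words (n : nat) (pi : 'S_n) : word pi \in words n.
Proof.
apply/mem_wordsP; split.
- by rewrite size_map size_enum_ord.
- rewrite map_inj_uniq ?enum_uniq //.
  by apply: inj_comp; [apply: val_inj | apply: perm_inj].
- by apply/allP => _ /mapP[i _ ->]; apply: ltn_ord.
Qed.

Lemma perm_word_words (n : nat) :
  perm_eq [seq word pi | pi <- enum 'S_n] (words n).
Proof.
have us : uniq [seq word pi | pi <- enum 'S_n].
  by rewrite (map_inj_uniq (@word_inj n)) enum_uniq.
have sub : {subset [seq word pi | pi <- enum 'S_n] <= words n}.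
  by move=> _ /mapP[pi _ ->]; apply: word_words.
have sz : size (words n) <= size [seq word pi | pi <- enum 'S_n].
  by rewrite size_words size_map -cardE card_Sn.
apply: uniq_perm => //; last by case: (uniq_min_size us sub sz).
exact: leq_size_uniq us sub sz.
Qed.

(** * Recurrences for sums over avoiding words *)

Lemma big_words (n : nat) (P : pred (seq nat)) (F : seq nat -> nat) :
  \sum_(s <- words n.+1 | P s) F s =
  \sum_(s <- words n) \sum_(0 <= x < n.+1 | P (prepend x s)) F (prepend x s).
Proof.
rewrite big_mkcond big_allpairs_dep /=.
by apply: eq_bigr => s _; rewrite -big_mkcond.
Qed.

(** An arbitrary weight [phi] captures the joint distribution of the first letter and [ndes]; the
    recurrences trade [phi] for other weights. *)
Definition wsum Q (P : pred (seq nat)) n (phi : nat -> nat -> nat) : nat :=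
  \sum_(s <- words n | avoids Q s && P s) phi (head 0 s) (ndes s).

Lemma sum_start_down Q n (F : seq nat -> nat) :
  order_invariant Q -> starts_231 Q ->
  \sum_(s <- words n.+1 | avoids Q s && ~~ starts_up s) F s =
  \sum_(s <- words n | avoids Q s)
    \sum_(0 <= y < n.+1 | head 0 s < y) F (prepend y s).
Proof.
move=> Qm Qr; rewrite big_words [RHS]big_mkcond.
apply: eq_big_seq => s /size_word sz.
(* Prepending preserves existing occurrences, so a word [s] containing one contributes nothing. *)
case: (boolP (avoids Q s)) => av; last first.
  by rewrite big1 // => x; rewrite avoids_prepend // (negbTE av) andbF.
rewrite big_nat_cond [RHS]big_nat_cond; apply: eq_bigl => y.
case: (ltnP y n.+1) => yn; rewrite ?andbF // andTb.
rewrite avoids_prepend // av andbT starts_up_prepend ?sz // -ltnNge.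
by case: ltnP => zy; rewrite ?andbF // avoids_head_prepend ?zy ?orbT.
Qed.

Lemma wsum_down Q n phi :
  order_invariant Q -> starts_231 Q ->
  wsum Q (fun s => ~~ starts_up s) n.+1 phi =
  wsum Q xpredT n (fun y d => \sum_(0 <= x < n.+1 | y < x) phi x d.+1).
Proof.
move=> Qm Qr; rewrite /wsum sum_start_down //.
rewrite [LHS]big_seq_cond [RHS]big_seq_cond.
apply: eq_big => s; rewrite ?andbT // => /andP[/size_word sz _].
rewrite big_nat_cond [RHS]big_nat_cond; apply: eq_bigr => x /andP[xn yx].
by rewrite ndes_prepend ?sz // yx.
Qed.

(** A letter not above the head adds no descent. It is always safe over a word starting up; over an
    initial descent it may create an occurrence, whence the second sum. *)
Lemma wsum_up Q n phi :
  order_invariant Q -> starts_231 Q ->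
  wsum Q starts_up n.+1 phi =
  wsum Q starts_up n (fun y d => \sum_(0 <= x < n.+1 | x <= y) phi x d) +
  \sum_(s <- words n | avoids Q s && ~~ starts_up s)
    \sum_(0 <= x < n.+1 | (x <= head 0 s) && avoids_head Q (prepend x s))
      phi x (ndes s).
Proof.
move=> Qm Qr; rewrite /wsum big_words.
rewrite [X in _ = X + _]big_mkcond [X in _ = _ + X]big_mkcond -big_split.
apply: eq_big_seq => s /size_word sz.
case: (boolP (avoids Q s)) => av; last first.
  by rewrite big1 // => x; rewrite avoids_prepend // (negbTE av) andbF.
transitivity (\sum_(0 <= x < n.+1 |
    (x <= head 0 s) && avoids_head Q (prepend x s)) phi x (ndes s)).
  rewrite big_nat_cond [RHS]big_nat_cond; apply: eq_big => x; last first.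
    case/andP => xn /andP[_]; rewrite starts_up_prepend ?sz // => xy.
    by rewrite ndes_prepend ?sz // ltnNge xy.
  case: (ltnP x n.+1) => xn; rewrite ?andbF // andTb.
  by rewrite avoids_prepend // av andbT starts_up_prepend ?sz // andbC.
case: (boolP (starts_up s)) => us; last by [].
rewrite [RHS]addn0; apply: eq_bigl => x.
by rewrite avoids_head_prepend ?us ?andbT.
Qed.

(** * Letters allowed before an initial descent *)

Lemma avoids_head2314 (m x y : nat) (s : seq nat) :
  s \in words m -> head 0 s < y < m.+1 -> x <= y ->
  avoids_head Q2314 (prepend x (prepend y s)) = (x <= head 0 s) || (y == m).
Proof.
case: s => [|z t] sm /=; first by move: sm => /size_word /= <-; lia.
move=> yb xy; have memv v := words_mem v sm; rewrite /Q2314 -map_comp.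
have -> : bump x y = y.+1 by rewrite /bump xy.
have -> : bump y z = z by rewrite /bump; lia.
rewrite has_map; case: (leqP x z) => xz /=.
  by apply/hasPn => u _ /=; rewrite /bump; lia.
have [->|ym] /= := eqVneq y m.
  apply/hasPn => u ut /=; have := memv u; rewrite inE ut orbT /bump; lia.
(* As [y < m], the letter [y] of [s] lies in its tail; raised twice to [y+2], it exceeds the [y+1]
   in second position. *)
apply/negbF/hasP; exists y; last by rewrite /= /bump; lia.
by have := memv y; rewrite inE; lia.
Qed.

(** When [x] exceeds the head of [s], the fourth letter must end strictly between [x] and [y+1], so
    it comes from a letter [u] of [s] with [x <= u < y]; [u = x] is one as soon as [x < y]. *)
Lemma avoids_head2413 (m x y : nat) (s : seq nat) :
  s \in words m -> head 0 s < y < m.+1 -> x <= y ->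
  avoids_head Q2413 (prepend x (prepend y s)) = (x <= head 0 s) || (x == y).
Proof.
case: s => [|z t] sm /=; first by move: sm => /size_word /= <-; lia.
move=> yb xy; have memv v := words_mem v sm; rewrite /Q2413 -map_comp.
have -> : bump x y = y.+1 by rewrite /bump xy.
have -> : bump y z = z by rewrite /bump; lia.
rewrite has_map; case: (leqP x z) => xz /=.
  by apply/hasPn => u _ /=; rewrite /bump; lia.
have [->|xny] /= := eqVneq x y.
  by apply/hasPn => u ut /=; rewrite /bump; lia.
apply/negbF/hasP; exists x; last by rewrite /= /bump; lia.
by have := memv x; rewrite inE; lia.
Qed.

(** Pairs with [x <= z] agree on both sides. Each [x] with [z < x <= m] then occurs once more on
    either side, with [y = m] or with [y = x]. *)
Lemma sum_admissible (m z : nat) (f : nat -> nat) :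
  \sum_(0 <= y < m.+1 | z < y)
    \sum_(0 <= x < m.+2 | (x <= y) && ((x <= z) || (y == m))) f x =
  \sum_(0 <= y < m.+1 | z < y)
    \sum_(0 <= x < m.+2 | (x <= y) && ((x <= z) || (x == y))) f x.
Proof.
have split_le (c : nat -> nat -> bool) :
  \sum_(0 <= y < m.+1 | z < y)
    \sum_(0 <= x < m.+2 | (x <= y) && ((x <= z) || c x y)) f x =
  \sum_(0 <= y < m.+1 | z < y) \sum_(0 <= x < m.+2 | x <= z) f x +
  \sum_(0 <= y < m.+1 | z < y)
    \sum_(0 <= x < m.+2 | [&& z < x, x <= y & c x y]) f x.
  rewrite -big_split; apply: eq_bigr => y zy.
  rewrite (bigID (fun x => x <= z)) /=.
  congr (_ + _); apply: eq_bigl => x; move: (c x y) => b; lia.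
rewrite (split_le (fun x y => y == m)) (split_le (fun x y => x == y)).
congr (_ + _); transitivity (\sum_(0 <= x < m.+1 | z < x) f x).
  transitivity (\sum_(0 <= y < m.+1 | y == m) \sum_(0 <= x < m.+1 | z < x) f x).
    rewrite [LHS]big_mkcond [RHS]big_mkcond; apply: eq_bigr => y _.
    have [->|ym] := eqVneq y m; last first.
      by case: ifP => // _; apply: big1 => x; rewrite !andbF.
    (* When [m <= z], neither side has a term. *)
    rewrite [RHS](big_nat_widen _ _ m.+2) //; case: ltnP => zm.
      by apply: eq_bigl => x; rewrite andbT ltnS.
    by rewrite big1 // => x; lia.
  by rewrite big_nat1_eq ltnSn.
rewrite big_nat_cond [RHS]big_nat_cond; apply: eq_bigr => y /andP[yb zy].
transitivity (\sum_(0 <= x < m.+2 | x == y) f x).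
  by rewrite big_nat1_eq ifT //; lia.
by apply: eq_bigl => x; lia.
Qed.

(** A word starting with a descent is [prepend y s] with [y] above the head [z] of [s]; this descent
    gives [d.+1]. The condition specific to the pattern is abstracted as [c]. *)
Lemma sum_double_prepend Q (c : nat -> nat -> nat -> bool) n
    (phi : nat -> nat -> nat) :
  order_invariant Q -> starts_231 Q ->
  (forall m x y s, s \in words m -> head 0 s < y < m.+1 -> x <= y ->
     avoids_head Q (prepend x (prepend y s)) = (x <= head 0 s) || c m x y) ->
  \sum_(s <- words n.+1 | avoids Q s && ~~ starts_up s)
    \sum_(0 <= x < n.+2 | (x <= head 0 s) && avoids_head Q (prepend x s))
      phi x (ndes s) =
  wsum Q xpredT n (fun z d => \sum_(0 <= y < n.+1 | z < y)
    \sum_(0 <= x < n.+2 | (x <= y) && ((x <= z) || c n x y)) phi x d.+1).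
Proof.
move=> Qm Qr Qc; rewrite sum_start_down // /wsum.
rewrite [LHS]big_seq_cond [RHS]big_seq_cond.
apply: eq_big => s; rewrite ?andbT // => /andP[sn _].
have sz := size_word sn.
rewrite big_nat_cond [RHS]big_nat_cond; apply: eq_bigr => y /andP[yn zy].
rewrite ndes_prepend ?sz // zy; apply: eq_bigl => x.
by case: leqP => // xy; rewrite (Qc n) ?zy.
Qed.

Lemma wsum_split Q n phi :
  wsum Q xpredT n phi =
  wsum Q starts_up n phi + wsum Q (fun s => ~~ starts_up s) n phi.
Proof.
rewrite /wsum (bigID starts_up).
by congr (_ + _); apply: eq_bigl => s; rewrite andbT.
Qed.

Lemma eq_wsum Q P n phi psi :
  phi =2 psi -> wsum Q P n phi = wsum Q P n psi.
Proof. by move=> e; apply: eq_bigr. Qed.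

(** * Equidistribution by induction on the length *)

Lemma wsum_2314_2413 (n : nat) (phi : nat -> nat -> nat) :
  wsum Q2314 xpredT n phi = wsum Q2413 xpredT n phi.
Proof.
(* The second statement is carried along because [wsum_up] recurses on it; [phi] stays general
   because the weights change. *)
suff: (forall phi, wsum Q2314 xpredT n phi = wsum Q2413 xpredT n phi) /\
      (forall phi, wsum Q2314 starts_up n phi = wsum Q2413 starts_up n phi).
  by case.
have im1 := order_invariant2314; have im2 := order_invariant2413.
have r1 := starts_231_2314; have r2 := starts_231_2413.
elim/ltn_ind: n {phi} => -[|n] IH.
  by split=> phi; rewrite /wsum /= !big_cons !big_nil.
have up phi : wsum Q2314 starts_up n.+1 phi = wsum Q2413 starts_up n.+1 phi.
  rewrite !wsum_up //; congr (_ + _); first exact: (IH n _).2.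
  (* The remaining sum reaches words two letters shorter, hence the strong induction; over the empty
     word it has no term. *)
  case: n IH => [|n] IH; first by rewrite !big_cons !big_nil.
  rewrite (sum_double_prepend (c := fun m _ y => y == m) _ _
    im1 r1 avoids_head2314).
  rewrite (sum_double_prepend (c := fun _ x y => x == y) _ _
    im2 r2 avoids_head2413).
  rewrite -(IH n _).1 ?ltnS ?leqnSn //.
  by apply: eq_wsum => z d; apply: sum_admissible.
split=> // phi; rewrite !wsum_split up; congr (_ + _).
by rewrite !wsum_down // (IH n _).1.
Qed.

(** * Return to permutations and vincular patterns *)

Lemma des_ndes (n : nat) (pi : 'S_n) : des pi = ndes (word pi).
Proof.
have ndesE s : ndes s = \sum_(i < (size s).-1) (nth 0 s i.+1 < nth 0 s i).
  elim: s => [|x [|y s] IHs]; rewrite ?big_ord0 //.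
  by rewrite big_ord_recl -[RHS]/(_ + _) -IHs.
rewrite -(ndes_map (f := S)) // -one_lineE ndesE.
rewrite /des size_map size_enum_ord -sum1dep_card big_mkcond.
by apply: eq_bigr => i _; case: ltnP.
Qed.

Lemma avoidersE (Q : nat -> nat -> nat -> nat -> bool) (w : 4.-tuple nat)
    (n : nat) (pi : 'S_n) :
  order_invariant Q ->
  (forall a b c d, order_isomorphic [:: a; b; c; d] w = Q a b c d) ->
  (pi \in avoiders n w) = avoids Q (word pi).
Proof.
move=> Qm Qw; rewrite -(avoids_map (f := S)) // -one_lineE inE.
have sz : size (one_line pi) = n by rewrite size_map size_enum_ord.
apply/idP/avoidsP => [/existsPn H i j ij|H].
  rewrite sz => jn; have lin : i < n by lia.
  have /existsPn/(_ (Ordinal jn)) := H (Ordinal lin).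
  by rewrite /occurs_at /= ij Qw.
apply/existsPn => i; apply/existsPn => j.
rewrite /occurs_at Qw; case: leqP => //= ij.
by apply: H; rewrite ?sz.
Qed.

(** Quantifiers over ordinals become list checks that compute, leaving comparisons that [lia]
    decides. *)
Lemma order_isomorphicE (a b c d : nat) (t : seq nat) :
  order_isomorphic [:: a; b; c; d] t =
  (size t == 4) &&
  all (fun i => all (fun j =>
         (nth 0 [:: a; b; c; d] i < nth 0 [:: a; b; c; d] j)
           == (nth 0 t i < nth 0 t j)) (iota 0 4)) (iota 0 4).
Proof.
rewrite /order_isomorphic eq_sym; congr (_ && _).
apply/forallP/allP => [H i|H i].
  rewrite mem_iota => li; apply/allP => j; rewrite mem_iota => lj.
  exact: (forallP (H (Ordinal (li : i < 4))) (Ordinal (lj : j < 4))).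
apply/forallP => j; move: (H i); rewrite mem_iota => /(_ (ltn_ord i)).
by move=> /allP/(_ j); rewrite mem_iota => /(_ (ltn_ord j)).
Qed.

Lemma order_isomorphic2314 a b c d :
  order_isomorphic [:: a; b; c; d] [tuple 2; 3; 1; 4] = Q2314 a b c d.
Proof. by rewrite order_isomorphicE /Q2314 /=; lia. Qed.

Lemma order_isomorphic2413 a b c d :
  order_isomorphic [:: a; b; c; d] [tuple 2; 4; 1; 3] = Q2413 a b c d.
Proof. by rewrite order_isomorphicE /Q2413 /=; lia. Qed.

Lemma card_avoiders_des Q (w : 4.-tuple nat) (n m : nat) :
  order_invariant Q ->
  (forall a b c d, order_isomorphic [:: a; b; c; d] w = Q a b c d) ->
  #|[set pi in avoiders n w | des pi == m]| =
  wsum Q xpredT n (fun _ d => nat_of_bool (d == m)).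
Proof.
move=> Qm Qw; rewrite /wsum -(perm_big _ (perm_word_words n)) big_map.
rewrite big_enum_cond -sum1dep_card big_mkcondr.
apply: eq_big => pi; first by rewrite andbT -(avoidersE _ Qm Qw).
by rewrite des_ndes; case: eqP.
Qed.

Theorem theorem3p4 :
  des_Wilf_equivalent [tuple 2; 3; 1; 4] [tuple 2; 4; 1; 3].
Proof.
move=> n m _.
rewrite (card_avoiders_des _ _ order_invariant2314 order_isomorphic2314).
rewrite (card_avoiders_des _ _ order_invariant2413 order_isomorphic2413).
exact: wsum_2314_2413.
Qed.
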